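(* Let $(X,E)$ be an mq-space. Then $(D(X),\triangle_E,\nabla_E)$ is subdirectly irreducible but not simple if and only if exactly one of the following holds: (a') $\overline{\min X}^{\mathcal S}=X$ and $\nabla_E(D(X))\setminus\{X\}$ has a greatest element (with respect to inclusion) which is different from $\emptyset$; (b') there is $x\in X$ with $x\notin\overline{\min X}^{\mathcal S}$, $X=\overline{\min X}^{\mathcal S}\cup\{x\}$ and $E([x))=X$.
   Context: Notation: $E(Z)=\{y:(x,y)\in E$ for some $x\in Z\}$, $E(x)=E(\{x\})$; in a poset $(Y]$, $[Y)$ are the generated down-/up-sets, $[x)=[\{x\})$; $\max Y$, $\min Y$ maximal/minimal elements. A Priestley space is a compact space with a partial order such that whenever $x\not\le y$ there is a clopen increasing $U$ with $x\in U$, $y\notin U$; $D(X)$ = clopen increasing subsets. A q-space is $(X,E)$ with $X$ Priestley and $E$ an equivalence relation with $E(U)\in D(X)$ for $U\in D(X)$ and closed classes; an mq-space additionally satisfies (mq1) $(x,y)\in E$, $y\le z$ imply some $w$ with $x\le w$, $(w,z)\in E$; (mq2) $(E(X\setminus V)]$ is clopen for $V\in D(X)$. On $D(X)$: $\nabla_E U=E(U)$, $\triangle_E U=X\setminus(E(X\setminus U)]$; this gives an m-lattice, whose congruences are lattice congruences compatible with $\triangle_E,\nabla_E$. $\nabla_E(D(X))=\{E(U):U\in D(X)\}$. A subset $Y$ is $id$-saturated if $\min E([y))\cup\max E(y)\subseteq Y$ for all $y\in Y$. $\overline{Y}^{\mathcal S}$ is the intersection of all subsets of $X$ that are closed (in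 the topology of $X$), $id$-saturated, and contain $Y$ (the closure in the topology $\tau_{\mathcal S}$ whose closed sets are the closed $id$-saturated sets). *)

(* Defs.v *)
From HB Require Import structures.
From mathcomp Require Import all_boot all_order.
From mathcomp Require Import all_classical topology.

Set Implicit Arguments.
Unset Strict Implicit.
Unset Printing Implicit Defensive.

Import Order.TTheory.

Local Open Scope order_scope.
Local Open Scope classical_set_scope.

(* A carrier equipped with both a topology and a partial order; no
   compatibility between the two is built in. *)
Notation porderTopologicalType := POrderedTopological.type.

Section OrderedSets.
Context {d : Order.disp_t} {X : porderTopologicalType d}.
Implicit Types (x y : X) (U Y : set X).

Definition upset Y : set X := [set x | exists2 y, Y y & y <= x].
Definition downset Y : set X := [set x | exists2 y, Y y & x <= y].

Definition minimals Y : set X :=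
  [set x | Y x /\ forall y, Y y -> y <= x -> y = x].
Definition maximals Y : set X :=
  [set x | Y x /\ forall y, Y y -> x <= y -> y = x].

Definition increasing_set U : Prop := forall x y, U x -> x <= y -> U y.

Definition clopen_increasing U : Prop := clopen U /\ increasing_set U.

Definition priestley : Prop :=
  compact [set: X] /\
  forall x y, ~~ (x <= y) -> exists U, [/\ clopen_increasing U, U x & ~ U y].

End OrderedSets.

Arguments priestley {d} X.

(* The set D(X) as a type, with the lattice structure inherited from (set X, subset). *)
Section DualLattice.
Context {d : Order.disp_t} (X : porderTopologicalType d).

Definition clopen_increasingb : {pred set X} :=
  [pred U : set X | `[< clopen_increasing U >]].

Record dual_lattice := DualLattice {
  dual_val :> set X;
  dual_valP : dual_val \in clopen_increasingb
}.

HB.instance Definition _ := [isSub for dual_val].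
HB.instance Definition _ := [Choice of dual_lattice by <:].

Fact clopen_increasingI :
  {in clopen_increasingb &, forall U V, U `&` V \in clopen_increasingb}%O.
Proof.
move=> U V; rewrite !inE => -[cU iU] [cV iV].
split; first exact: clopenI.
by move=> x y [Ux Vx] xy; split; [exact: iU xy|exact: iV xy].
Qed.

Fact clopen_increasingU :
  {in clopen_increasingb &, forall U V, U `|` V \in clopen_increasingb}%O.
Proof.
move=> U V; rewrite !inE => -[cU iU] [cV iV].
split; first exact: clopenU.
by move=> x y [Ux|Vx] xy; [left; exact: iU xy|right; exact: iV xy].
Qed.

Fact clopen_increasing0 : \bot%O \in clopen_increasingb.
Proof. by rewrite inE; split; [exact: clopen0|]. Qed.

Fact clopen_increasingT : \top%O \in clopen_increasingb.
Proof. by rewrite inE; split; [exact: clopenT|]. Qed.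

HB.instance Definition _ :=
  Order.isTBLatticeClosed.Build set_display (set X) clopen_increasingb
    clopen_increasingI clopen_increasingU
    clopen_increasing0 clopen_increasingT.

HB.instance Definition _ :=
  [SubChoice_isTBSubLattice of dual_lattice by <: with set_display].

End DualLattice.

Arguments clopen_increasingb {d} X.

Section MLattices.
Context {d : Order.disp_t} {L : latticeType d}.
Variables (tri nab : L -> L).

Record m_congruence (R : L -> L -> Prop) : Prop := MCongruence {
  m_congruence_equiv : RelationClasses.Equivalence R;
  m_congruence_meet : forall a a' b b' : L,
    R a a' -> R b b' -> R (a `&` b)%O (a' `&` b')%O;
  m_congruence_join : forall a a' b b' : L,
    R a a' -> R b b' -> R (a `|` b)%O (a' `|` b')%O;
  m_congruence_tri : forall a a' : L, R a a' -> R (tri a) (tri a');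
  m_congruence_nab : forall a a' : L, R a a' -> R (nab a) (nab a')
}.

Definition m_simple : Prop :=
  (exists a b : L, a <> b) /\
  forall R, m_congruence R ->
    (forall a b, R a b <-> a = b) \/ (forall a b, R a b).

(* Existence of a monolith; a one-element algebra has none, so it is neither
   subdirectly irreducible nor simple under these conventions. *)
Definition m_subdirectly_irreducible : Prop :=
  exists M, [/\ m_congruence M, ~ (forall a b, M a b <-> a = b) &
    forall R, m_congruence R -> ~ (forall a b, R a b <-> a = b) ->
      forall a b, M a b -> R a b].

End MLattices.

Section MQSpaces.
Context {d : Order.disp_t} {X : porderTopologicalType d}.
Variable E : X -> X -> Prop.
Implicit Types (x y z w : X) (U V Y Z : set X).

Definition rel_image Z : set X := [set y | exists2 x, Z x & E x y].

Record q_space : Prop := QSpace {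
  q_priestley : priestley X;
  q_equiv : RelationClasses.Equivalence E;
  q_image : forall U, clopen_increasing U -> clopen_increasing (rel_image U);
  q_closed : forall x, closed (rel_image [set x])
}.

Record mq_space : Prop := MQSpace {
  mq_q : q_space;
  mq_lift : forall x y z, E x y -> y <= z -> exists2 w, x <= w & E w z;
  mq_clopen : forall V, clopen_increasing V ->
    clopen (downset (rel_image (~` V)))
}.

Definition nabla U : set X := rel_image U.
Definition triangle U : set X := ~` downset (rel_image (~` U)).

Fact dual_latticeP (U : dual_lattice X) : clopen_increasing U.
Proof. by have := dual_valP U; rewrite inE. Qed.

Fact nablaP (mqE : mq_space) (U : dual_lattice X) :
  nabla U \in clopen_increasingb X.
Proof.
by rewrite inE; apply/(q_image (mq_q mqE))/dual_latticeP.
Qed.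

Fact triangleP (mqE : mq_space) (U : dual_lattice X) :
  triangle U \in clopen_increasingb X.
Proof.
rewrite inE; split.
  exact: (@clopenC _ _ set0 (mq_clopen mqE (dual_latticeP U))).
by move=> x y nx xy [z Ez yz]; apply: nx; exists z => //; exact: le_trans yz.
Qed.

Definition dual_nabla (mqE : mq_space) (U : dual_lattice X) : dual_lattice X :=
  DualLattice (nablaP mqE U).
Definition dual_triangle (mqE : mq_space) (U : dual_lattice X) :
  dual_lattice X := DualLattice (triangleP mqE U).

Definition id_saturated Y : Prop := forall y, Y y ->
  minimals (rel_image (upset [set y])) `|` maximals (rel_image [set y]) `<=` Y.

Definition S_closure Y : set X :=
  \bigcap_(Z in [set Z | [/\ closed Z, id_saturated Z & Y `<=` Z]]) Z.

Definition nabla_range : set (set X) := nabla @` [set U | clopen_increasing U].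

Definition condition_a : Prop :=
  S_closure (minimals [set: X]) = [set: X] /\
  exists G : set X, [/\ (nabla_range `\ [set: X]) G,
    forall H, (nabla_range `\ [set: X]) H -> H `<=` G & G <> set0].

Definition condition_b : Prop :=
  exists x, [/\ ~ S_closure (minimals [set: X]) x,
    [set: X] = S_closure (minimals [set: X]) `|` [set x] &
    rel_image (upset [set x]) = [set: X]].

End MQSpaces.

(* Main.v *)
(* By Priestley duality, the congruences of the m-lattice D(X) correspond, with
   the order reversed, to the closed id-saturated subsets Y of X: two clopen
   increasing sets are identified when they have the same trace on Y.  Hence
   D(X) is subdirectly irreducible but not simple iff the proper closed
   id-saturated sets have a greatest element Y, and Y is nonempty.

   Let C be the S-closure of min X.  A closed id-saturated set containing a
   point x with E([x)) = X contains C, and a point x with E([x)) <> X lies in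
   some member of nabla(D(X)) other than X; members of nabla(D(X)) are closed
   and id-saturated.  If C = X, this makes Y the greatest proper member of
   nabla(D(X)).  If C <> X, the points x with E([x)) = X form a single E-class,
   because two classes cofinal in each other share a maximal element; that
   class contains a minimal point of X, so its maximal elements are in C.
   Hence, for x outside Y, the set C together with x is closed and
   id-saturated, and so it is X. *)
Require Import Defs.
From mathcomp Require Import all_boot all_order.
From mathcomp Require Import all_classical topology.

Set Implicit Arguments.
Unset Strict Implicit.
Unset Printing Implicit Defensive.

Import Order.TTheory.

Local Open Scope order_scope.
Local Open Scope classical_set_scope.

(** * Compactness arguments *)

Section Compactness.
Context {T : topologicalType}.

(** Replaces the choice of a finite subcover: a union-stable property that holds on a neighbourhood
    of each point passes to a set containing all of [K]. *)
Lemma compact_induction (K : set T) (P : set T -> Prop) :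
  compact K -> P set0 -> (forall U V, P U -> P V -> P (U `|` V)) ->
  (forall x, K x -> exists U, [/\ open U, U x & P U]) ->
  exists2 U, P U & K `<=` U.
Proof.
move=> /compact_near_coveringP cK P0 PU Px.
(* [F] is the filter of tails of [P] directed by inclusion; stability under unions gives its
   intersection axiom. *)
pose F : set_system (set T) := [set Q | exists2 W, P W &
  forall W', P W' -> W `<=` W' -> Q W'].
have FF : Filter F.
  split; first by exists set0.
    move=> A B [V PV AV] [W PW BW]; exists (V `|` W); first exact: PU.
    by move=> Z PZ VWZ; split; [apply: AV|apply: BW] => // x Hx; apply: VWZ;
      [left|right].
  by move=> A B AB [W PW AW]; exists W => // Z PZ WZ; exact/AB/AW.
have [] := cK _ F (fun U x => U x) FF.
  move=> x /Px[U [oU Ux PUx]].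
  exists (U, [set W | U `<=` W]) => /=.
    by split; [exact: open_nbhs_nbhs|exists U].
  by move=> [y W] /= [Uy]; exact.
by move=> W PW KW; exists W => //; exact: KW.
Qed.

(* [R] is meant to be the order or its opposite. *)
Lemma compact_extremal (R : rel T) (C : set T) (c : T) :
  compact [set: T] -> reflexive R -> transitive R -> antisymmetric R ->
  (forall a, closed [set x | R a x]) -> closed C -> C c ->
  exists m, [/\ C m, R c m & forall y, C y -> R m y -> y = m].
Proof.
move=> cT Rr Rt Ra Rc clC Cc.
pose S := {x : T | C x /\ R c x}.
have chain_bound (A : set S) : total_on A (fun s t => R (sval s) (sval t)) ->
    exists t : S, forall s, A s -> R (sval s) (sval t).
  move=> tA; have [[a0 Aa0]|A0] := pselect (A !=set0); last first.
    by exists (exist _ c (conj Cc (Rr c))) => s As; case: A0; exists s.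
  have [[x [Cx Ax]]|nx] :=
      pselect (exists x, C x /\ forall s, A s -> R (sval s) x).
    have cx : R c x by apply: Rt (Ax _ Aa0); have [] := svalP a0.
    by exists (exist _ x (conj Cx cx)).
  (* If no point of [C] bounds the chain, each point has a neighbourhood whose points of [C] all
     fail to bound one member of the chain. As the chain is total, one member [a] serves for the
     whole space, yet [a] is in [C] and bounds itself. *)
  have [||x _|W [a Aa aW] TW] := @compact_induction [set: T]
      [set W | exists2 a, A a & forall x, W x -> C x -> ~ R (sval a) x] cT.
  - by exists a0.
  - move=> U V [a Aa aU] [b Ab bV].
    have [ab|ba] := tA _ _ Aa Ab; [exists b|exists a] => // x [] Wx Cx.
    + by move=> bx; exact: aU Wx Cx (Rt _ _ _ ab bx).
    + exact: bV.
    + exact: aU.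
    + by move=> ax; exact: bV Wx Cx (Rt _ _ _ ba ax).
  - have [Cx|nCx] := pselect (C x); last first.
      by exists (~` C); split; [rewrite openC| |exists a0].
    have [a [Aa nax]] : exists a, A a /\ ~ R (sval a) x.
      apply: contrapT => na; apply: nx; exists x; split => // s As.
      by apply: contrapT => nsx; apply: na; exists s.
    exists (~` [set y | R (sval a) y]); split => //; first by rewrite openC.
    by exists a => // y.
  - by have [Ca _] := svalP a; case: (aW (sval a) (TW _ I) Ca); exact: Rr.
have [||||m mP] := @Zorn S (fun s t => R (sval s) (sval t)).
- by move=> s; exact: Rr.
- by move=> r s t; exact: Rt.
- move=> [s Hs] [t Ht] /= st ts; apply: eq_exist; apply: Ra.
  by rewrite st ts.
- exact: chain_bound.
exists (sval m); have [Cm cm] := svalP m; split => // y Cy my.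
by have <- := mP (exist _ y (conj Cy (Rt _ _ _ cm my))) my.
Qed.

End Compactness.

(** * Separation and extremal points in Priestley spaces *)

Section Priestley.
Context {d : Order.disp_t} {X : porderTopologicalType d}.
Hypothesis prX : priestley X.
Implicit Types (x y : X) (A B C U V Y : set X).

Lemma clopen_increasing_setI U V :
  clopen_increasing U -> clopen_increasing V -> clopen_increasing (U `&` V).
Proof.
move=> cU cV; have := @clopen_increasingI _ X U V.
by rewrite !inE; exact.
Qed.

Lemma clopen_increasing_setU U V :
  clopen_increasing U -> clopen_increasing V -> clopen_increasing (U `|` V).
Proof.
move=> cU cV; have := @clopen_increasingU _ X U V.
by rewrite !inE; exact.
Qed.

Lemma clopen_increasing_set0 : clopen_increasing (@set0 X).
Proof. by have := clopen_increasing0 X; rewrite inE. Qed.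

Lemma clopen_increasing_setT : clopen_increasing [set: X].
Proof. by have := clopen_increasingT X; rewrite inE. Qed.

Lemma closed_compact_priestley A : closed A -> compact A.
Proof. by move=> clA; exact: subclosed_compact clA prX.1 _. Qed.

Lemma priestley_closed_ge x : closed [set y | x <= y].
Proof.
rewrite -openC openE => y /negP /(prX.2 _ _) [U [[[oU cU] iU] Ux nUy]].
rewrite /interior; apply: (@filterS _ _ _ (~` U)).
  by move=> z nUz xz; apply: nUz; exact: iU xz.
by apply: open_nbhs_nbhs; split => //; rewrite openC.
Qed.

Lemma priestley_closed_le x : closed [set y | y <= x].
Proof.
rewrite -openC openE => y /negP /(prX.2 _ _) [U [[[oU cU] iU] Uy nUx]].
rewrite /interior; apply: (@filterS _ _ _ U).
  by move=> z Uz zx; apply: nUx; exact: iU zx.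
exact: open_nbhs_nbhs.
Qed.

Lemma priestley_closed1 x : closed [set x].
Proof.
have -> : [set x] = [set y | x <= y] `&` [set y | y <= x].
  apply/seteqP; split => y /= => [->|[xy yx]]; first by rewrite lexx.
  by apply/eqP; rewrite eq_le yx xy.
by apply: closedI; [exact: priestley_closed_ge|exact: priestley_closed_le].
Qed.

(** Compactness is used twice: for a fixed point of [A], finitely many separating sets are
    intersected to avoid [B]; then finitely many of the results are united to cover [A]. *)
Lemma priestley_separation A B : closed A -> closed B ->
  (forall a b, A a -> B b -> ~ a <= b) ->
  exists U, [/\ clopen_increasing U, A `<=` U & forall b, B b -> ~ U b].
Proof.
move=> clA clB AB.
have sep a : A a -> exists U, [/\ clopen_increasing U, U a & forall b, B b -> ~ U b].
  move=> Aa; have [||b Bb|W [U [cU Ua UW]] BW] := @compact_induction _ B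
      [set W | exists U, [/\ clopen_increasing U, U a & forall b, W b -> ~ U b]]
      (closed_compact_priestley clB).
  - by exists setT; split => //; exact: clopen_increasing_setT.
  - move=> V W [U1 [c1 a1 d1]] [U2 [c2 a2 d2]]; exists (U1 `&` U2).
    split => //; first exact: clopen_increasing_setI.
    by move=> b [] Hb [? ?]; [exact: d1 Hb _|exact: d2 Hb _].
  - have [U [cU Ua nUb]] := prX.2 a b (introN idP (AB _ _ Aa Bb)).
    exists (~` U); split => //; first by rewrite openC; case: cU => -[].
    by exists U.
  - by exists U; split => // b Bb; exact/UW/BW.
have [||a Aa|U [cU UB] AU] := @compact_induction _ A
    [set U | clopen_increasing U /\ forall b, B b -> ~ U b]
    (closed_compact_priestley clA).
- by split; [exact: clopen_increasing_set0|move=> b _ []].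
- move=> U V [cU UB] [cV VB]; split; first exact: clopen_increasing_setU.
  by move=> b Bb [/UB|/VB]; exact.
- have [U [cU Ua UB]] := sep a Aa; exists U; split => //.
  by case: cU => -[].
- by exists U.
Qed.

Lemma priestley_maximal C c : closed C -> C c -> exists2 m, maximals C m & c <= m.
Proof.
move=> clC Cc; have [|||m [Cm cm mP]] := @compact_extremal _ (fun x y => x <= y)
  C c prX.1 _ _ _ priestley_closed_ge clC Cc; last by exists m.
- by move=> x; exact: lexx.
- by move=> y x z; exact: le_trans.
- by move=> x y; exact: le_anti.
Qed.

Lemma priestley_minimal C c : closed C -> C c -> exists2 m, minimals C m & m <= c.
Proof.
move=> clC Cc; have [|||m [Cm cm mP]] := @compact_extremal _ (fun x y => y <= x)
  C c prX.1 _ _ _ priestley_closed_le clC Cc; last by exists m.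
- by move=> x; exact: lexx.
- by move=> y x z yx zy; exact: le_trans zy yx.
- by move=> x y xy; apply: le_anti; rewrite andbC.
Qed.

(** [V] contains the part of [Y] above [m] and misses [B]; maximality of [m] makes this possible.
    What remains of [Y] outside [V] is not above [m], so [V] can be enlarged to contain [m] without
    changing its trace on [Y]. *)
Lemma separate_maximal Y B m : closed Y -> closed B -> ~ Y m ->
  (forall b, B b -> m <= b -> b = m) ->
  exists U V, [/\ clopen_increasing U, clopen_increasing V,
    U `&` Y = V `&` Y, U m & forall b, B b -> ~ V b].
Proof.
move=> clY clB nYm mB.
have [|w b [Yw /= mw] Bb wb|V [cV WV VB]] :=
    @priestley_separation (Y `&` [set w | m <= w]) B _ clB.
- by apply: closedI => //; exact: priestley_closed_ge.
- apply: nYm; rewrite -(_ : w = m) //; apply: le_anti; rewrite mw andbT.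
  by rewrite -(mB b Bb (le_trans mw wb)).
have [|a z -> [Yz nVz] mz|U [cU mU UY]] :=
    @priestley_separation [set m] (Y `&` ~` V) (@priestley_closed1 m).
- by apply: closedI => //; rewrite closedC; case: cV => -[].
- by apply: nVz; exact: WV.
exists (U `|` V), V; split => //; first exact: clopen_increasing_setU.
  apply/seteqP; split => z [UVz Yz]; last by split => //; right.
  split => //; case: UVz => // Uz; apply: contrapT => nVz.
  exact: (UY z).
by left; exact: mU.
Qed.

(** Order dual of [separate_maximal]: [U] contains [C] and misses the part of [Y] below [m], and is
    then shrunk to omit [m] with the same trace on [Y]. *)
Lemma separate_minimal Y C m : closed Y -> closed C -> ~ Y m ->
  (forall c, C c -> c <= m -> c = m) ->
  exists U V, [/\ clopen_increasing U, clopen_increasing V,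
    U `&` Y = V `&` Y, C `<=` U & ~ V m].
Proof.
move=> clY clC nYm mC.
have [|c w Cc [Yw /= wm] cw|U [cU CU UW]] :=
    @priestley_separation C (Y `&` [set w | w <= m]) clC.
- by apply: closedI => //; exact: priestley_closed_le.
- apply: nYm; rewrite -(_ : w = m) //; apply: le_anti; rewrite wm /=.
  by rewrite -(mC c Cc (le_trans cw wm)).
have [|z a [Yz Uz] -> zm|V [cV YV Vm]] :=
    @priestley_separation (Y `&` U) [set m] _ (@priestley_closed1 m).
- by apply: closedI => //; case: cU => -[].
- exact: (UW z).
exists U, (U `&` V); split => //; first exact: clopen_increasing_setI.
  apply/seteqP; split => z [Uz Yz]; last by split => //; case: Uz.
  by split => //; split => //; exact: YV.
by move=> [_]; exact: Vm.
Qed.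

End Priestley.

(** * Classes, saturated sets and the S-closure in q-spaces *)

Section QSpaces.
Context {d : Order.disp_t} {X : porderTopologicalType d} (E : X -> X -> Prop).
Hypothesis qE : q_space E.
Implicit Types (x y z : X) (F U V : set X).

Let prX : priestley X := q_priestley qE.

Lemma q_refl x : E x x.
Proof. by have [r _ _] := q_equiv qE; exact: r. Qed.

Lemma q_sym x y : E x y -> E y x.
Proof. by have [_ s _] := q_equiv qE; exact: s. Qed.

Lemma q_trans x y z : E x y -> E y z -> E x z.
Proof. by have [_ _ t] := q_equiv qE; exact: t. Qed.

Lemma rel_image1 x : rel_image E [set x] = E x.
Proof. by apply/seteqP; split => [y [_ ->]//|y Exy]; exists x. Qed.

Lemma rel_image_upP x z :
  rel_image E (upset [set x]) z <-> exists2 w, x <= w & E w z.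
Proof.
split => [[w [_ -> xw] Ewz]|[w xw Ewz]]; first by exists w.
by exists w => //; exists x.
Qed.

Lemma q_closed_class x : closed (E x).
Proof. by rewrite -rel_image1; exact: q_closed. Qed.

Lemma sub_rel_image U : U `<=` rel_image E U.
Proof. by move=> x Ux; exists x => //; exact: q_refl. Qed.

Lemma rel_image_sat U x y : rel_image E U x -> E x y -> rel_image E U y.
Proof. by move=> [u Uu Eux] Exy; exists u => //; exact: q_trans Exy. Qed.

(* A maximal element of one class lies below a maximal element of the other,
   and conversely, so the two classes share a maximal element. *)
Lemma cofinal_classes x y :
  (forall a, E x a -> exists2 b, E y b & a <= b) ->
  (forall b, E y b -> exists2 a, E x a & b <= a) -> E x y.
Proof.
move=> xy yx.
have [m [Exm mmax] _] := priestley_maximal prX (@q_closed_class x) (q_refl x).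
have [n Eyn mn] := xy _ Exm; have [p Exp np] := yx _ Eyn.
have pm : p = m by apply: mmax => //; exact: le_trans np.
rewrite pm in np; have nm : n = m by apply: le_anti; rewrite np mn.
by rewrite nm in Eyn; apply: q_trans Exm _; exact: q_sym.
Qed.

Lemma separate_from_class x y : (forall b, E y b -> ~ x <= b) ->
  exists U, [/\ clopen_increasing U, U x & ~ rel_image E U y].
Proof.
move=> xy; have [|U [cU xU Uy]] :=
    priestley_separation prX (priestley_closed1 prX (x := x)) (@q_closed_class y).
  by move=> _ b -> Eyb; exact: xy.
exists U; split => //; first exact: xU.
by move=> [u Uu Euy]; apply: (Uy u) => //; exact: q_sym.
Qed.

(** If no E(U) with U clopen increasing told the two points apart, [separate_from_class] would make
    their classes cofinal in each other, hence equal. *)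
Lemma separate_classes x y : ~ E x y -> exists W,
  [/\ clopen W, forall a b, W a -> E a b -> W b, W x & ~ W y].
Proof.
move=> nExy; have [[U [cU xy]]|nU] := pselect (exists U, clopen_increasing U /\
  ((rel_image E U x /\ ~ rel_image E U y) \/
   (rel_image E U y /\ ~ rel_image E U x))).
  have [cEU _] := q_image qE cU; case: xy => -[h1 h2].
    by exists (rel_image E U); split => // a b; exact: rel_image_sat.
  exists (~` rel_image E U); split => //.
  - exact: (@clopenC _ _ set0).
  - by move=> a b nUa Eab Ub; apply: nUa; apply: rel_image_sat Ub _; exact: q_sym.
exfalso; apply: nExy; apply: cofinal_classes => a Ea; apply: contrapT => nb.
  have [b Eb ab|U [cU Ua nUy]] := @separate_from_class a y.
    by apply: nb; exists b.
  apply: nU; exists U; split => //; left; split => //.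
  by exists a => //; exact: q_sym.
have [b Eb ab|U [cU Ua nUx]] := @separate_from_class a x.
  by apply: nb; exists b.
apply: nU; exists U; split => //; right; split => //.
by exists a => //; exact: q_sym.
Qed.

(** A point [z] outside E(F) is separated from each point of [F] by a saturated clopen set. A finite
    union of these covers [F], hence E(F) by saturation, and misses [z]. *)
Lemma rel_image_closed F : closed F -> closed (rel_image E F).
Proof.
move=> clF; rewrite -openC openE => z nFz.
have [||f Ff|W [cW sW nWz] FW] := @compact_induction _ F
    [set W | [/\ clopen W, forall a b, W a -> E a b -> W b & ~ W z]]
    (closed_compact_priestley prX clF).
- by split; [exact: clopen0|move=> ? ? []|case].
- move=> U V [cU sU nUz] [cV sV nVz]; split; first exact: clopenU.
    by move=> a b [Ua|Va] Eab; [left; exact: sU Eab|right; exact: sV Eab].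
  by move=> [].
- have [Efz|W [cW sW Wf nWz]] := @separate_classes f z.
    by apply: nFz; exists f.
  by exists W; split => //; case: cW.
rewrite /interior; apply: (@filterS _ _ _ (~` W)).
  by move=> y nWy [f Ff Efy]; apply: nWy; apply: sW Efy; exact: FW.
by apply: open_nbhs_nbhs; split => //; rewrite openC; case: cW.
Qed.

Lemma rel_image_up_closed x : closed (rel_image E (upset [set x])).
Proof.
apply: rel_image_closed.
have -> : upset [set x] = [set y | x <= y].
  by apply/seteqP; split => [y [_ -> //]|y xy]; exists x.
exact: priestley_closed_ge.
Qed.

Lemma nabla_range_closed G : nabla_range E G -> closed G.
Proof. by move=> [U /(q_image qE) [[_ ?] _] <-]. Qed.

(** E(U) is both increasing and a union of classes, so it contains all of E([y)) for each of its
    points y. *)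
Lemma nabla_range_id_saturated G : nabla_range E G -> id_saturated E G.
Proof.
move=> [U cU <-] y Uy z; have [_ iU] := q_image qE cU.
case=> [[/rel_image_upP[w yw Ewz] _]|[]].
  by apply: rel_image_sat Ewz; exact: iU yw.
by rewrite rel_image1 => Eyz _; exact: rel_image_sat Eyz.
Qed.

(** A point [w] outside E([z)) has no class member above [z], so [separate_from_class] yields U
    containing [z] with E(U) missing [w]. *)
Lemma proper_nabla_cover z : rel_image E (upset [set z]) <> setT ->
  exists G, [/\ nabla_range E G, G z & G <> setT].
Proof.
move=> nT; have [w nw] : exists w, ~ rel_image E (upset [set z]) w.
  apply: contrapT => nw; apply: nT; apply/seteqP; split => // w _.
  by apply: contrapT => nzw; apply: nw; exists w.
have [b Eb zb|U [cU Uz nUw]] := @separate_from_class z w.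
  by apply: nw; apply/rel_image_upP; exists b => //; exact: q_sym.
exists (rel_image E U); split; first by exists U.
  exact: sub_rel_image.
by move=> UT; apply: nUw; rewrite UT.
Qed.

Lemma minimals_S_closure Z z : closed Z -> id_saturated E Z -> Z z ->
  rel_image E (upset [set z]) = setT -> S_closure E (minimals setT) `<=` Z.
Proof.
move=> clZ sZ Zz zT x; apply; split => // y my.
by apply: (sZ z Zz); left; rewrite zT.
Qed.

Lemma S_closure_closed F : closed (S_closure E F).
Proof. by apply: closed_bigI => Z []. Qed.

Lemma S_closure_id_saturated F : id_saturated E (S_closure E F).
Proof.
move=> y Fy z yz Z HZ; have [_ sZ _] := HZ.
by apply: sZ yz; exact: Fy.
Qed.

Lemma sub_S_closure F : F `<=` S_closure E F.
Proof. by move=> x Fx Z [_ _]; exact. Qed.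

Definition proper_S_closed Z : Prop :=
  [/\ closed Z, id_saturated E Z & Z <> [set: X]].

Lemma proper_S_closed_cover Z z : S_closure E (minimals setT) = setT ->
  proper_S_closed Z -> Z z -> exists G, [/\ nabla_range E G, G z & G <> setT].
Proof.
move=> CT [clZ sZ ZT] Zz; apply: proper_nabla_cover => zT; apply: ZT.
apply/seteqP; split => // x _; apply: (minimals_S_closure clZ sZ Zz zT).
by rewrite CT.
Qed.

End QSpaces.

(** * Conditions (a') and (b') and the greatest proper S-closed set *)

Section MQSpaces.
Context {d : Order.disp_t} {X : porderTopologicalType d} (E : X -> X -> Prop).
Hypothesis mqE : mq_space E.
Implicit Types (x y z : X) (Y Z U V : set X).

Let qE : q_space E := mq_q mqE.
Let prX : priestley X := q_priestley qE.

(** The class of either point has a member above the other point; (mq1) carries this to every point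
    of that other class, so the classes are cofinal in each other. *)
Lemma full_cone_unique_class x y :
  rel_image E (upset [set x]) = setT -> rel_image E (upset [set y]) = setT ->
  E x y.
Proof.
have dom u v a : rel_image E (upset [set u]) = setT -> E u a ->
    exists2 b, E v b & a <= b.
  move=> uT Eua; have : rel_image E (upset [set u]) v by rewrite uT.
  move=> /rel_image_upP[w uw Ewv].
  have [b ab Ebw] := mq_lift mqE (q_sym qE Eua) uw.
  by exists b => //; apply: (q_sym qE); exact: (q_trans qE) Ebw Ewv.
by move=> xT yT; apply: (cofinal_classes qE) => a; exact: dom.
Qed.

(** A minimal point [x0] of X below [x] also has E([x0)) = X, hence lies in the class of [x].
    Saturation at [x0] gives the maximal points of that class. *)
Lemma full_cone_maximals x : rel_image E (upset [set x]) = setT ->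
  maximals (E x) `<=` S_closure E (minimals setT).
Proof.
move=> xT; have [x0 mx0 x0x] := priestley_minimal prX (@closedT X) (I : setT x).
have x0T : rel_image E (upset [set x0]) = setT.
  apply/seteqP; split => // z _; have : rel_image E (upset [set x]) z by rewrite xT.
  move=> /rel_image_upP[w xw Ewz]; apply/rel_image_upP; exists w => //.
  exact: le_trans xw.
have Exx0 := full_cone_unique_class xT x0T.
have ExE : E x = E x0.
  by apply/seteqP; split => z; apply: (q_trans qE) => //; exact: (q_sym qE).
move=> m; rewrite ExE => mm.
apply: (S_closure_id_saturated (sub_S_closure mx0)); right.
by rewrite rel_image1.
Qed.

Definition greatest_proper_S_closed Y : Prop :=
  proper_S_closed E Y /\ forall Z, proper_S_closed E Z -> Z `<=` Y.

Lemma condition_a_greatest : condition_a E ->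
  exists2 Y, greatest_proper_S_closed Y & Y !=set0.
Proof.
move=> [CT [G [[rG GT] Gmax G0]]]; exists G; last exact/set0P/eqP.
split.
  split; [exact: (nabla_range_closed qE)|exact: (nabla_range_id_saturated qE)|].
  exact: GT.
move=> Z pZ z Zz; have [H [rH Hz HT]] := proper_S_closed_cover qE CT pZ Zz.
by apply: (Gmax H).
Qed.

Lemma condition_b_greatest : condition_b E ->
  exists2 Y, greatest_proper_S_closed Y & Y !=set0.
Proof.
move=> [x [nCx CxT xT]]; exists (S_closure E (minimals setT)); last first.
  have [m mm _] := priestley_minimal prX (@closedT X) (I : setT x).
  by exists m; exact: sub_S_closure.
split.
  split; [exact: S_closure_closed|exact: S_closure_id_saturated|].
  by move=> CT; apply: nCx; rewrite CT.
move=> Z [clZ sZ ZT] z Zz.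
have : (S_closure E (minimals setT) `|` [set x]) z by rewrite -CxT.
case=> // zx; exfalso; apply: ZT; apply/seteqP; split => // y _.
rewrite zx in Zz; have CZ := minimals_S_closure clZ sZ Zz xT.
have : (S_closure E (minimals setT) `|` [set x]) y by rewrite -CxT.
by case=> [/CZ//|->].
Qed.

(** [Y] is a union of proper members of the range of nabla. As nabla preserves unions, compactness
    makes [Y] itself a member. *)
Lemma greatest_condition_a Y : S_closure E (minimals setT) = setT ->
  greatest_proper_S_closed Y -> Y !=set0 -> condition_a E.
Proof.
move=> CT [pY Ymax] Y0; split => //; have [clY sY YT] := pY.
have rY G : nabla_range E G -> G <> setT -> G `<=` Y.
  move=> rG GT; apply: Ymax; split => //; first exact: (nabla_range_closed qE).
  exact: (nabla_range_id_saturated qE).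
have [||y Yy|G [rG GY] YG] := @compact_induction _ Y
    [set G | nabla_range E G /\ G `<=` Y] (closed_compact_priestley prX clY).
- split; last by move=> ? [].
  exists set0; first exact: clopen_increasing_set0.
  by apply/seteqP; split => z // [].
- move=> _ _ [[U cU <-] UY] [[V cV <-] VY]; split; last by move=> z [/UY|/VY].
  exists (U `|` V); first exact: clopen_increasing_setU.
  apply/seteqP; split => z.
    by move=> [u [Uu|Vu] Euz]; [left|right]; exists u.
  by move=> [[u Hu Euz]|[u Hu Euz]]; exists u => //; [left|right].
- have [G [rG Gy GT]] := proper_S_closed_cover qE CT pY Yy.
  exists G; split => //; last by split => //; exact: rY.
  by case: rG => U /(q_image qE) [[oU _] _] <-.
have GE : G = Y by apply/seteqP.
exists Y; split; first by split; [rewrite -GE|exact: YT].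
  by move=> H [rH HT]; exact: rY.
by apply/eqP/set0P.
Qed.

Lemma greatest_condition_b Y : S_closure E (minimals setT) <> setT ->
  greatest_proper_S_closed Y -> condition_b E.
Proof.
move=> CT [[clY sY YT] Ymax].
have CY : S_closure E (minimals setT) `<=` Y.
  apply: Ymax; split => //; first exact: S_closure_closed.
  exact: S_closure_id_saturated.
have [x nYx] : exists x, ~ Y x.
  apply: contrapT => nx; apply: YT; apply/seteqP; split => // x _.
  by apply: contrapT => nYx; apply: nx; exists x.
have xT : rel_image E (upset [set x]) = setT.
  apply: contrapT => /(proper_nabla_cover qE)[G [rG Gx GT]].
  apply: nYx; apply: Ymax Gx; split => //; first exact: (nabla_range_closed qE).
  exact: (nabla_range_id_saturated qE).
exists x; split => //; first by move=> /CY.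
apply: contrapT => CxT; apply: nYx.
apply: (Ymax (S_closure E (minimals setT) `|` [set x])); last by right.
split; last exact: nesym.
  by apply: closedU; [exact: S_closure_closed|exact: priestley_closed1].
(* At [x], saturation asks for the minimal points of E([x)) = X and the maximal points of the class
   of [x]; both already lie in the S-closure. *)
move=> y [Cy|->] z; first by move=> /(S_closure_id_saturated Cy); left.
rewrite xT rel_image1 => -[mz|mz]; left; first exact: sub_S_closure.
exact: full_cone_maximals mz.
Qed.

Lemma conditions_greatest : condition_a E \/ condition_b E <->
  exists2 Y, greatest_proper_S_closed Y & Y !=set0.
Proof.
split=> [[/condition_a_greatest//|/condition_b_greatest//]|[Y gY Y0]].
have [CT|CT] := pselect (S_closure E (minimals setT) = setT).
  by left; exact: greatest_condition_a gY Y0.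
by right; exact: greatest_condition_b gY.
Qed.

Lemma conditions_exclusive : condition_a E -> ~ condition_b E.
Proof. by move=> [CT _] [x [nCx _ _]]; apply: nCx; rewrite CT. Qed.

End MQSpaces.

(** * Duality between congruences and closed id-saturated sets *)

Section Congruences.
Context {d : Order.disp_t} {X : porderTopologicalType d} (E : X -> X -> Prop).
Hypothesis mqE : mq_space E.
Implicit Types (x y z : X) (Y W : set X) (a b u v : dual_lattice X).
Implicit Types R : dual_lattice X -> dual_lattice X -> Prop.

Let qE : q_space E := mq_q mqE.
Let prX : priestley X := q_priestley qE.

Local Notation m_cong := (m_congruence (dual_triangle mqE) (dual_nabla mqE)).

Lemma dual_lattice_of (U : set X) :
  clopen_increasing U -> {a : dual_lattice X | dual_val a = U}.
Proof.
move=> cU; have cUb : U \in clopen_increasingb X by rewrite inE.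
by exists (DualLattice cUb).
Qed.

Lemma dual_lattice_eqP a b :
  (forall x, dual_val a x <-> dual_val b x) -> a = b.
Proof.
by move=> ab; apply: val_inj; apply/seteqP; split => x /ab.
Qed.

Definition agree_on Y a b : Prop :=
  forall x, Y x -> (dual_val a x <-> dual_val b x).

(** The closed set dual to a congruence, inverse to [agree_on]. *)
Definition cong_support R : set X := [set x | forall a b, R a b ->
  (dual_val a x <-> dual_val b x)].

Lemma triangleE (U : set X) y :
  triangle E U y <-> rel_image E (upset [set y]) `<=` U.
Proof.
split=> [ty z /rel_image_upP[w yw Ewz]|yU [z [w nUw Ewz] yz]].
  apply: contrapT => nUz; apply: ty; exists w => //.
  by exists z => //; exact: (q_sym qE).
apply: nUw; apply: yU; apply/rel_image_upP; exists z => //.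
exact: (q_sym qE).
Qed.

(** For increasing U, membership of y in triangle U is decided at the minimal points of E([y)), and
    in nabla U at the maximal points of E(y). Saturation keeps these points in [Y]. *)
Lemma agree_on_congruence Y : id_saturated E Y -> m_cong (agree_on Y).
Proof.
move=> sY.
have half_tri a b : agree_on Y a b -> forall y, Y y ->
    triangle E (dual_val a) y -> triangle E (dual_val b) y.
  move=> ab y Yy /triangleE ya; apply/triangleE => e ye.
  have [m mm me] := priestley_minimal prX (rel_image_up_closed qE (x := y)) ye.
  have [_ ib] := dual_latticeP b; apply: ib me; apply/ab.
    by apply: (sY y Yy); left.
  by apply: ya; case: mm.
have half_nab a b : agree_on Y a b -> forall y, Y y ->
    nabla E (dual_val a) y -> nabla E (dual_val b) y.
  move=> ab y Yy [u au Euy].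
  have [m mm um] := priestley_maximal prX (q_closed_class qE (x := y)) (q_sym qE Euy).
  exists m; last by apply: (q_sym qE); case: mm.
  apply/ab; first by apply: (sY y Yy); right; rewrite rel_image1.
  by have [_ ia] := dual_latticeP a; exact: ia um.
have agreeC a b : agree_on Y a b -> agree_on Y b a.
  by move=> ab x Yx; have [? ?] := ab x Yx; split.
split.
- split=> [a x //|a b|a b c ab bc x Yx]; first exact: agreeC.
  by rewrite (propext (ab x Yx)); exact: bc.
- move=> a a' b b' aa bb x Yx /=; have [? ?] := aa x Yx; have [? ?] := bb x Yx.
  by split=> -[? ?]; split; auto.
- move=> a a' b b' aa bb x Yx /=; have [? ?] := aa x Yx; have [? ?] := bb x Yx.
  by split=> -[?|?]; [left|right|left|right]; auto.
- by move=> a b ab x Yx; split; apply: half_tri => //; exact: agreeC.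
- by move=> a b ab x Yx; split; apply: half_nab => //; exact: agreeC.
Qed.

Lemma cong_support_closed R : closed (cong_support R).
Proof.
have -> : cong_support R = \bigcap_(p in [set p | R p.1 p.2])
    [set x | dual_val p.1 x <-> dual_val p.2 x].
  apply/seteqP; split => [x sx [a b] /= ab|x sx a b ab]; first exact: sx.
  exact: (sx (a, b)).
apply: closed_bigI => -[a b] _ /=.
have [[oa ca] _] := dual_latticeP a; have [[ob cb] _] := dual_latticeP b.
have -> : [set x | dual_val a x <-> dual_val b x] =
    (dual_val a `&` dual_val b) `|` (~` dual_val a `&` ~` dual_val b).
  apply/seteqP; split => x /=.
    by case=> abx bax; have [ax|nax] := pselect (dual_val a x); [left|right];
      split => //; [exact: abx|move=> /bax].
  by case=> -[ax bx]; split.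
by apply: closedU; apply: closedI => //; rewrite closedC.
Qed.

Lemma agree_on_support Y : closed Y -> cong_support (agree_on Y) = Y.
Proof.
move=> clY; apply/seteqP; split => x; last by move=> Yx a b; exact.
move=> sx; apply: contrapT => nYx.
(* With the singleton of [x] as the set to avoid, this yields two sets equal on [Y] and different at
   [x]. *)
have [b -> //|U [V [cU cV UV Ux Vx]]] :=
  separate_maximal prX clY (priestley_closed1 prX (x := x)) nYx.
have [a aU] := dual_lattice_of cU; have [b bV] := dual_lattice_of cV.
have ab : agree_on Y a b.
  move=> y Yy; rewrite aU bV.
  split=> Hy; first by have [] : (V `&` Y) y by rewrite -UV.
  by have [] : (U `&` Y) y by rewrite UV.
have := sx a b ab; rewrite aU bV => -[/(_ Ux) Vx' _].
by apply: (Vx x).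
Qed.

Section OneCongruence.
Variable R : dual_lattice X -> dual_lattice X -> Prop.
Hypothesis mR : m_cong R.

Let Rrefl a : R a a.
Proof. by have [r _ _] := m_congruence_equiv mR; exact: r. Qed.

Let Rsym a b : R a b -> R b a.
Proof. by have [_ s _] := m_congruence_equiv mR; exact: s. Qed.

Let Rtrans a b c : R a b -> R b c -> R a c.
Proof. by have [_ _ t] := m_congruence_equiv mR; exact: t. Qed.

(** The order of the quotient lattice. *)
Let Rle a b := R (a `|` b)%O b.

(* The cut rule of distributive lattices, read in the quotient by [R]. *)
Let Rle_cut u v b : Rle (u `&` b)%O v -> Rle u (v `|` b)%O -> Rle u v.
Proof.
move=> ubv uvb; rewrite /Rle.
have h1 : R (u `|` v)%O ((u `|` v) `&` (v `|` b))%O.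
  have := m_congruence_meet mR (Rrefl (u `|` v)%O) uvb.
  suff -> : ((u `|` v) `&` (u `|` (v `|` b)))%O = (u `|` v)%O by [].
  apply: dual_lattice_eqP => x /=; split=> [[]//|[ux|vx]].
    by split; left.
  by split; right => //; left.
apply: Rtrans h1 _; suff -> : ((u `|` v) `&` (v `|` b))%O = (u `&` b `|` v)%O by [].
apply: dual_lattice_eqP => x /=; split.
  by case=> -[ux|vx] [vx'|bx]; [right|left|right|right].
by case=> [[ux bx]|vx]; [split; [left|right]|split; [right|left]].
Qed.

(** Says that [W] is negligible modulo [R]: inclusion outside [W] is enough for the quotient
    order. *)
Let covers W := forall u v,
  (forall x, dual_val u x -> dual_val v x \/ W x) -> Rle u v.

(** Cut on [b]: inside [b] the new difference is empty, while joining [v] with [b] is, modulo [R],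
    joining it with [a], which contains the difference. *)
Let covers_diff W a b : R a b -> covers W ->
  covers (W `|` (dual_val a `&` ~` dual_val b)).
Proof.
move=> ab cW u v uvW; apply: (@Rle_cut _ _ b).
  by apply: cW => x [ux bx]; case: (uvW x ux) => [vx|[Wx|[_ /(_ bx)]]//];
    [left|right].
have h : Rle u (v `|` a)%O.
  by apply: cW => x ux; case: (uvW x ux) => [vx|[Wx|[ax _]]];
    [left; left|right|left; right].
have vab := m_congruence_join mR (Rrefl v) ab.
apply: Rtrans (Rtrans h vab); apply: (m_congruence_join mR (Rrefl u)).
exact: Rsym.
Qed.

(** Each point of [u] outside [v] is off the support, so it lies in a difference of two [R]-related
    elements. Finitely many such differences cover, and [covers_diff] absorbs them one at a time. *)
Let support_Rle u v :
  (forall x, cong_support R x -> dual_val u x -> dual_val v x) -> Rle u v.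
Proof.
move=> uv; have [[ou cu] _] := dual_latticeP u; have [[ov cv] _] := dual_latticeP v.
have cl : closed (dual_val u `&` ~` dual_val v).
  by apply: closedI => //; rewrite closedC.
have [||x [ux nvx]|W PW uW] := @compact_induction _ (dual_val u `&` ~` dual_val v)
    (* Adding [W] preserves negligibility; this form, unlike [covers] alone, is visibly stable under
       unions. *)
    [set W | forall W', covers W' -> covers (W' `|` W)]
    (closed_compact_priestley prX cl).
- by move=> W'; rewrite setU0.
- by move=> U V PU PV W' cW'; rewrite setUA; exact/PV/PU.
- have [a [b [ab ax nbx]]] :
      exists a b, [/\ R a b, dual_val a x & ~ dual_val b x].
    apply: contrapT => nab; apply: nvx; apply: uv ux => a b ab.
    by split => h; apply: contrapT => nh; apply: nab; [exists a, b|exists b, a];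
      split => //; exact: Rsym.
  exists (dual_val a `&` ~` dual_val b); split => //.
    have [[oa _] _] := dual_latticeP a; have [[_ cb] _] := dual_latticeP b.
    by apply: openI => //; rewrite openC.
  by move=> W'; exact: covers_diff.
have c0 : covers set0.
  move=> a b ab; rewrite /Rle; suff -> : (a `|` b)%O = b by [].
  apply: dual_lattice_eqP => x /=; split; last by right.
  by case=> // /ab[].
apply: (PW _ c0) => x ux; have [vx|nvx] := pselect (dual_val v x); first by left.
by right; right; exact: uW.
Qed.

Lemma agree_on_cong_support a b : agree_on (cong_support R) a b <-> R a b.
Proof.
split=> [ab|ab x]; last exact.
have h1 : Rle a b by apply: support_Rle => x /ab[].
have h2 : Rle b a by apply: support_Rle => x /ab[].
apply: Rtrans h1; apply: Rsym; suff -> : (a `|` b)%O = (b `|` a)%O by [].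
by rewrite joinC.
Qed.

(** If a required point [m] were off the support, two sets with the same trace on the support, hence
    [R]-related, would have triangles (or nablas) that differ at [y]. *)
Lemma cong_support_id_saturated : id_saturated E (cong_support R).
Proof.
move=> y sy m ym; apply: contrapT => nsm.
have clS := @cong_support_closed R.
have lift (U V : set X) : clopen_increasing U -> clopen_increasing V ->
    U `&` cong_support R = V `&` cong_support R ->
    exists a b, [/\ dual_val a = U, dual_val b = V & R a b].
  move=> cU cV UV.
  have [a aU] := dual_lattice_of cU; have [b bV] := dual_lattice_of cV.
  exists a, b; split => //; apply/agree_on_cong_support => x sx; rewrite aU bV.
  split=> Hx.
    by have [] : (V `&` cong_support R) x by rewrite -UV.
  by have [] : (U `&` cong_support R) x by rewrite UV.
case: ym => [[ym mmin]|[]].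
  have [U [V [cU cV UV yU nVm]]] :=
    separate_minimal prX clS (rel_image_up_closed qE (x := y)) nsm mmin.
  have [a [b [aU bV /(m_congruence_tri mR) ab]]] := lift _ _ cU cV UV.
  have := sy _ _ ab; rewrite /= aU bV => -[h _].
  have /triangleE yV : triangle E V y by apply: h; apply/triangleE.
  exact/nVm/yV.
rewrite rel_image1 => Eym mmax.
have [U [V [cU cV UV Um yV]]] :=
  separate_maximal prX clS (q_closed_class qE (x := y)) nsm mmax.
have [a [b [aU bV /(m_congruence_nab mR) ab]]] := lift _ _ cU cV UV.
have := sy _ _ ab; rewrite /= aU bV => -[h _].
have [|v Vv Evy] := h; first by exists m => //; exact: (q_sym qE).
by apply: (yV v) => //; exact: (q_sym qE).
Qed.

Lemma cong_support_identity :
  cong_support R = setT <-> (forall a b, R a b <-> a = b).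
Proof.
split=> [sT a b|Rid]; last first.
  by apply/seteqP; split => // x _ a b /Rid ->.
split=> [|-> //]; move=> ab; apply: dual_lattice_eqP => x.
have sx : cong_support R x by rewrite sT.
exact: sx.
Qed.

Lemma proper_cong_support : ~ (forall a b, R a b <-> a = b) ->
  proper_S_closed E (cong_support R).
Proof.
move=> nid; split; first exact: cong_support_closed.
  exact: cong_support_id_saturated.
by move=> /cong_support_identity.
Qed.

End OneCongruence.

Lemma agree_on_not_identity Y : proper_S_closed E Y ->
  ~ (forall a b, agree_on Y a b <-> a = b).
Proof.
move=> [clY sY YT] /(cong_support_identity (agree_on_congruence sY)).
by rewrite agree_on_support.
Qed.

(** The duality reverses inclusion, so the monolith corresponds to the greatest proper set. *)
Lemma subdirectly_irreducibleP :
  m_subdirectly_irreducible (dual_triangle mqE) (dual_nabla mqE) <->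
  exists Y, greatest_proper_S_closed E Y.
Proof.
split=> [[M [mM nM Mmin]]|[Y [pY Ymax]]].
  exists (cong_support M); split; first exact: proper_cong_support.
  move=> Z pZ z Zz a b Mab; have [clZ sZ _] := pZ.
  by apply: (Mmin _ (agree_on_congruence sZ) (agree_on_not_identity pZ)).
have [clY sY YT] := pY; exists (agree_on Y); split.
- exact: agree_on_congruence.
- exact: agree_on_not_identity.
move=> R mR nR a b ab; apply/(agree_on_cong_support mR) => x sx; apply: ab.
by apply: Ymax sx; exact: proper_cong_support.
Qed.

(** If [Y] is empty, every congruence other than equality has empty support and is total. A point of
    [Y] keeps X and the empty set apart in [agree_on Y], which is then neither equality nor
    total. *)
Lemma greatest_not_simple Y : greatest_proper_S_closed E Y ->
  ~ m_simple (dual_triangle mqE) (dual_nabla mqE) <-> Y !=set0.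
Proof.
move=> [pY Ymax]; have [clY sY YT] := pY; split=> [ns|[y Yy] [_ sim]].
  apply: contrapT => Y0; apply: ns; split.
    apply: contrapT => nab; apply: (agree_on_not_identity pY) => a b.
    split=> [_|-> //]; apply: contrapT => ab.
    by apply: nab; exists a, b.
  move=> R mR; have [Rid|nR] := pselect (forall a b, R a b <-> a = b).
    by left.
  right=> a b; apply/(agree_on_cong_support mR) => x sx; case: Y0; exists x.
  by apply: Ymax sx; exact: proper_cong_support.
case: (sim _ (agree_on_congruence sY)); first exact: agree_on_not_identity.
have [a aT] := dual_lattice_of (@clopen_increasing_setT _ X).
have [b b0] := dual_lattice_of (@clopen_increasing_set0 _ X).
by move=> /(_ a b y Yy); rewrite aT b0 => -[/(_ I)].
Qed.

End Congruences.

Theorem theorem2p6 (d : Order.disp_t) (X : porderTopologicalType d)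
    (E : X -> X -> Prop) (mqE : mq_space E) :
  (m_subdirectly_irreducible (dual_triangle mqE) (dual_nabla mqE) /\
   ~ m_simple (dual_triangle mqE) (dual_nabla mqE)) <->
  ((condition_a E /\ ~ condition_b E) \/ (~ condition_a E /\ condition_b E)).
Proof.
(* The two conditions disagree on whether the S-closure of min X is X, so the exclusive disjunction
   reduces to the plain one. *)
have excl := @conditions_exclusive _ _ E.
have -> : ((condition_a E /\ ~ condition_b E) \/
    (~ condition_a E /\ condition_b E)) <-> (condition_a E \/ condition_b E).
  by tauto.
rewrite conditions_greatest //; split.
  move=> [/subdirectly_irreducibleP[Y gY] ns]; exists Y => //.
  exact/(greatest_not_simple mqE gY).
move=> [Y gY Y0]; split; first by apply/subdirectly_irreducibleP; exists Y.
exact/(greatest_not_simple mqE gY).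
Qed.
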